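(* Let $C$ be a cycle of goods and $N$ a set of agents of at most $t$ types, where $t\ge4$. Then there exists a $\frac{t}{2t-2}$-sufficient allocation of the goods of $C$ to the agents in $N$.
   Context: A cycle of goods has goods $v_1,\dots,v_m$ with edges $v_iv_{i+1}$ and $v_mv_1$. A utility function assigns a non-negative real to each good, extended additively to sets. A bundle is a set of goods inducing a connected subgraph (empty allowed); an $n$-split is a sequence of $n$ pairwise disjoint bundles (possibly empty) with union all goods. $\mathrm{mms}^{(n)}(C,u)=\max_{P_1,\dots,P_n}\min_i u(P_i)$ over all $n$-splits. Agents are of the same type if they have the same utility function. An allocation to agents $1,\dots,n$ with utilities $u_1,\dots,u_n$ is an $n$-split $P_1,\dots,P_n$ with $P_i$ given to agent $i$; for $c>0$ it is $c$-sufficient if $u_i(P_i)\ge c\cdot\mathrm{mms}^{(n)}(C,u_i)$ for all $i$. *)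

(* Defs.v *)
From HB Require Import structures.
From mathcomp Require Import all_boot all_order all_algebra.
Set Implicit Arguments. Unset Strict Implicit. Unset Printing Implicit Defensive.
Import Order.TTheory GRing.Theory Num.Theory.
Local Open Scope ring_scope.

Definition cyc_adj (m : nat) (x y : 'I_m) : bool :=
  (val y == (val x).+1 %% m)%N || (val x == (val y).+1 %% m)%N.

Definition induced_adj (m : nat) (S : {set 'I_m}) : rel 'I_m :=
  fun a b => [&& a \in S, b \in S & cyc_adj a b].

Definition bundle (m : nat) (S : {set 'I_m}) : bool :=
  [forall x in S, forall y in S, connect (induced_adj S) x y].

Definition uval (R : realFieldType) (m : nat) (u : {ffun 'I_m -> R})
  (S : {set 'I_m}) : R := \sum_(g in S) u g.

Definition is_split (m n : nat) (P : {ffun 'I_n -> {set 'I_m}}) : bool :=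
  [&& [forall i, bundle (P i)],
      [forall i, forall j, (i != j) ==> [disjoint P i & P j]]
    & \bigcup_(i < n) P i == [set: 'I_m]].

(* mms^(n)(C,u) = max over n-splits of min_i u(P_i).  The neutral elements
   (0 for max, u(all goods) for min) do not affect the value when u >= 0 and
   n >= 1. *)
Definition mms (R : realFieldType) (m n : nat) (u : {ffun 'I_m -> R}) : R :=
  \big[Num.max/0]_(P : {ffun 'I_n -> {set 'I_m}} | is_split P)
     \big[Num.min/uval u [set: 'I_m]]_(i < n) uval u (P i).

Definition c_sufficient (R : realFieldType) (m n : nat) (c : R)
  (U : 'I_n -> {ffun 'I_m -> R}) (P : {ffun 'I_n -> {set 'I_m}}) : Prop :=
  is_split P /\ forall i : 'I_n, c * mms n (U i) <= uval (U i) (P i).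

(* Main.v *)
Require Import Defs.
From HB Require Import structures.
From mathcomp Require Import all_boot all_order all_algebra.
From mathcomp Require Import zify lra.
Import Order.TTheory GRing.Theory Num.Theory.
Local Open Scope ring_scope.

(* Let c = t / (2t - 2) <= 2/3.  An agent for whom a single good is worth c times
   her share can be given that good: the others still have n - 1 full bundles on
   the remaining path, and a moving knife serves them.  So let all goods be
   worth less.  The K agents of the two largest types satisfy t K >= 2 n, and
   there is a starting edge from which a moving knife always serves these two
   types.  Run the knife from there, preferring agents of the other types
   in case of ties.  For a waiting agent of another type with share M, the pieces
   given to the K agents are worth at most c M, and the others at most 2 c M.  If
   the knife stopped with such an agent left, she would value the whole cycle
   at less than c M (2 (n - K - 1) + K + 1) < n M, a contradiction. *)

(** * Tilings of an interval and the moving knife *)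

Set Implicit Arguments.
Unset Strict Implicit.

(** Agent [i] receives the half-open arc from [lo i] to [hi i]. [V i] stands for a cumulative value,
    so differences of [V i] are values of arcs. *)
Definition tiling (R : realFieldType) (n : nat) (V : 'I_n -> nat -> R)
    (theta : 'I_n -> R) (A : {set 'I_n}) (p E : nat) : Prop :=
  exists lo hi : 'I_n -> nat,
  [/\ forall i, i \in A ->
        [/\ (p <= lo i)%N, (lo i <= hi i)%N, (hi i <= E)%N
          & theta i <= V i (hi i) - V i (lo i)],
      forall x, (p <= x < E)%N -> exists2 i, i \in A & (lo i <= x < hi i)%N
    & forall i j, i \in A -> j \in A -> i != j ->
        (hi i <= lo j)%N || (hi j <= lo i)%N].

Lemma tiling1 (R : realFieldType) (n : nat) (V : 'I_n -> nat -> R)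
    (theta : 'I_n -> R) (i : 'I_n) (p E : nat) :
  (p <= E)%N -> theta i <= V i E - V i p -> tiling V theta [set i] p E.
Proof.
move=> pE ti; exists (fun=> p), (fun=> E); split.
- by move=> j /set1P->.
- by move=> x xE; exists i; rewrite ?set11.
- by move=> j k /set1P-> /set1P->; rewrite eqxx.
Qed.

Lemma tilingU1 (R : realFieldType) (n : nat) (V : 'I_n -> nat -> R)
    (theta : 'I_n -> R) (i : 'I_n) (A : {set 'I_n}) (p y E : nat) :
  i \notin A -> (p <= y)%N -> (y <= E)%N -> theta i <= V i y - V i p ->
  tiling V theta A y E -> tiling V theta (i |: A) p E.
Proof.
move=> iA py yE ti [lo [hi [lohi cov dis]]].
have neq j : j \in A -> (j == i) = false.
  by move=> jA; apply: contraNF iA => /eqP<-.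
exists (fun j => if j == i then p else lo j), (fun j => if j == i then y else hi j).
split.
- move=> j; rewrite in_setU1; case: eqVneq => [->|_] //= jA.
  by have [h1 h2 h3 h4] := lohi _ jA; split=> //; apply: leq_trans h1.
- move=> x /andP[px xE]; case: (ltnP x y) => xy.
    by exists i; rewrite ?setU11 // eqxx px xy.
  have [|j jA jx] := cov x; first by rewrite xy xE.
  by exists j; rewrite ?setU1r // neq.
- move=> j k; rewrite !in_setU1.
  case: (eqVneq j i) => [->|_] /=; case: (eqVneq k i) => [->|_] //=; rewrite ?eqxx //.
  + by move=> _ kA _; have [-> _ _ _] := lohi _ kA.
  + by move=> jA _ _; have [-> _ _ _] := lohi _ jA; rewrite orbT.
  + exact: dis.
Qed.

(** The serving loop as an induction: [Inv A p] describes the state with the agents of [A] waiting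
    and the knife at [p]. The last agent served takes all that is left up to [E]. *)
Lemma tiling_inv (R : realFieldType) (n : nat) (V : 'I_n -> nat -> R)
    (theta : 'I_n -> R) (E : nat) (Inv : {set 'I_n} -> nat -> Prop) :
  (forall i, {homo V i : x y / (x <= y)%N >-> x <= y}) ->
  (forall A p, A != set0 -> Inv A p -> exists i y,
     [/\ i \in A, (p <= y <= E)%N, theta i <= V i y - V i p & Inv (A :\ i) y]) ->
  forall A p, A != set0 -> Inv A p -> tiling V theta A p E.
Proof.
move=> Vmono step A; have [k] := ubnP #|A|; elim: k A => // k IH A Ak p A0 invA.
have [i [y [iA /andP[py yE] ti invA']]] := step _ _ A0 invA.
rewrite -(setD1K iA); have [A'0|A'N0] := eqVneq (A :\ i) set0.
  rewrite A'0 setU0; apply: tiling1; first exact: leq_trans yE.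
  by apply: le_trans ti _; rewrite lerB // Vmono.
apply: tilingU1 py yE ti _; first by rewrite !inE eqxx.
apply: IH => //; move: Ak; rewrite (cardsD1 i A) iA; lia.
Qed.

(* Moving knife: each time, the shortest arc worth theta to some remaining agent
   is cut off, ties being broken in favour of agents outside X.  The arcs
   given to X are then worth at most theta l, and the others at most
   2 * theta l, to any l outside X that is still waiting. *)
Lemma moving_knife (R : realFieldType) (n : nat) (V : 'I_n -> nat -> R)
    (theta : 'I_n -> R) (X : {set 'I_n}) (q : 'I_n -> nat -> nat) (p0 E : nat) :
  (0 < n)%N -> 
  (forall i, {homo V i : x y / (x <= y)%N >-> x <= y}) ->
  (forall i, 0 <= theta i) ->
  (forall j, j \in X -> (p0 <= q j 0)%N /\ (q j n <= E)%N) ->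
  (forall j k, j \in X -> (k < n)%N -> (q j k <= q j k.+1)%N) ->
  (forall j, j \in X -> exists i, theta i <= V i (q j 1) - V i (q j 0)) ->
  (forall j k, j \in X -> (0 < k < n)%N -> theta j <= V j (q j k.+1) - V j (q j k)) ->
  (forall l x, l \notin X -> V l x.+1 - V l x <= theta l) ->
  (forall l, l \notin X -> theta l * (2 * n - #|X| - 1)%:R <= V l E - V l p0) ->
  (p0 <= E)%N ->
  tiling V theta setT p0 E.
Proof.
move=> n0 Vmono th0 qend qmono q1 qk small total p0E.
(* Bounds, in multiples of [theta l], what the arc of [i] costs a waiting [l] outside [X]. The
   weights add up to [2 * n - #|X|]. *)
pose w (i : 'I_n) : nat := if i \in X then 1 else 2.
pose total_w := (\sum_i w i)%N.
have weight_arith a b s s' : (a + b = 2 * n -> a = s + (2 + s') -> s + 1 <= 2 * n - b - 1)%N.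
  by lia.
have sumw : (total_w + #|X| = 2 * n)%N.
  rewrite /total_w -sum1_card [X in (_ + X)%N]big_mkcond -big_split /=.
  rewrite (eq_bigr (fun=> 2%N)); last by move=> i _; rewrite /w; case: ifP.
  by rewrite sum_nat_const card_ord mulnC.
have qE j k : j \in X -> (k <= n)%N -> (q j k <= E)%N.
  move=> jX kn; apply: leq_trans (qend _ jX).2.
  have low d : (d <= n)%N -> (q j (n - d) <= q j n)%N.
    elim: d => [|d IH] dn; first by rewrite subn0.
    apply: leq_trans (IH (ltnW dn)).
    by have -> : (n - d = (n - d.+1).+1)%N; [lia | apply: qmono => //; lia].
  by rewrite -(subKn kn) low // leq_subr.
(* [n - #|A|] is the number of cuts made so far; the sum is the weight of the agents already
   served. *)
apply: (@tiling_inv _ _ V theta E (fun A p => [/\ (p0 <= p <= E)%N,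
   forall j, j \in X -> j \in A -> (p <= q j (n - #|A|))%N &
   forall l, l \notin X -> l \in A ->
     V l p - V l p0 <= theta l * (\sum_(i in ~: A) w i)%:R])) => //; last first.
- split; first by rewrite leqnn.
  + by move=> j jX _; rewrite cardsT card_ord subnn; apply: (qend _ jX).1.
  + by move=> l _ _; rewrite setCT big_set0 mulr0 subrr.
- by apply/set0Pn; exists (Ordinal n0).
move=> A p /set0Pn[i0 i0A] [/andP[p0p pE] invX invL].
have cA : (#|A| <= n)%N by rewrite -[X in (_ <= X)%N]card_ord max_card.
have cA0 : (0 < #|A|)%N by apply/card_gt0P; exists i0.
pose Q y := (p <= y)%N && [exists i in A, theta i <= V i y - V i p].
have QX j : j \in X -> j \in A -> Q (q j (n - #|A|).+1).
  move=> jX jA; have pq := invX j jX jA.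
  rewrite /Q (leq_trans pq) /=; last by apply: qmono => //; rewrite ltn_subrL cA0.
  (* For the first cut [q1] may name any agent as the one who stops the knife; at that moment all
     agents are waiting. *)
  apply/existsP; have [e|k0] := posnP (n - #|A|).
    rewrite e in pq *; have [i ti] := q1 j jX.
    have AT : A = setT by apply/eqP; rewrite eqEcard subsetT cardsT card_ord; lia.
    exists i; rewrite AT inE /=; apply: le_trans ti _.
    by rewrite lerB // Vmono.
  exists j; rewrite jA /=; apply: le_trans (qk j (n - #|A|)%N jX _) _; first lia.
  by rewrite lerB // Vmono.
have QE : Q E.
  rewrite /Q pE /=; have [/existsP[j /andP[jA jX]]|noX] := boolP [exists j in A, j \in X].
    have /andP[_ /existsP[i /andP[iA ti]]] := QX j jX jA.
    apply/existsP; exists i; rewrite iA; apply: le_trans ti _.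
    by rewrite lerB // Vmono // qE //; lia.
  have i0X : i0 \notin X.
    by apply: contra noX => i0X; apply/existsP; exists i0; rewrite i0A.
  apply/existsP; exists i0; rewrite i0A /=.
  have h1 := invL _ i0X i0A; have h2 := total _ i0X.
  (* The unserved [i0] has weight 2, so the served weight is at most [2 * n - #|X| - 2], which
     leaves [i0] an arc worth [theta i0]. *)
  have wle : ((\sum_(i in ~: A) w i) + 1 <= 2 * n - #|X| - 1)%N.
    have : (total_w = \sum_(i in ~: A) w i + \sum_(i in A) w i)%N.
      rewrite /total_w (bigID (mem (~: A))) /=; congr addn.
      by apply: eq_bigl => i; rewrite inE negbK.
    have wi0 : w i0 = 2%N by rewrite /w (negbTE i0X).
    rewrite (big_setD1 i0 i0A) /= wi0 => tw.
    exact: weight_arith sumw tw.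
  have : theta i0 * ((\sum_(i in ~: A) w i) + 1)%:R <= theta i0 * (2 * n - #|X| - 1)%:R.
    by rewrite ler_wpM2l // ler_nat.
  rewrite natrD mulrDr mulr1; lra.
have exQ : exists y, Q y by exists E.
case: (ex_minnP exQ) => y /andP[py Qy] ymin.
(* Tie-breaking: an agent of [X] is served only if every waiting outsider values the arc strictly
   below her threshold. *)
have [i [iA ti iL]] : exists i, [/\ i \in A, theta i <= V i y - V i p &
    i \in X -> forall l, l \in A -> l \notin X -> V l y - V l p < theta l].
  have [/existsP[l /and3P[lA lX tl]]|no] :=
      boolP [exists l, [&& l \in A, l \notin X & theta l <= V l y - V l p]].
    by exists l; split=> //; rewrite (negbTE lX).
  have /existsP[i /andP[iA ti]] := Qy; exists i; split=> // _ l lA lX.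
  rewrite ltNge; apply: contra no => tl; apply/existsP; exists l.
  by rewrite lA lX tl.
exists i, y; split=> //; first by rewrite py ymin.
have cAi : #|A| = #|A :\ i|.+1 by rewrite (cardsD1 i A) iA.
split; first by rewrite ymin // andbT (leq_trans p0p).
  move=> j jX; rewrite !inE => /andP[ji jA].
  have -> : (n - #|A :\ i| = (n - #|A|).+1)%N by rewrite cAi subnSK // -cAi.
  exact/ymin/QX.
move=> l lX; rewrite !inE => /andP[li lA].
have -> : (\sum_(k in ~: (A :\ i)) w k = w i + \sum_(k in ~: A) w k)%N.
  rewrite (big_setD1 i) /=; last by rewrite !inE eqxx.
  congr addn; apply: eq_bigl => k; rewrite !inE negb_and negbK.
  by case: eqVneq => //= ->; rewrite iA.
have old := invL l lX lA.
suff : V l y - V l p <= theta l * (w i)%:R.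
  rewrite natrD mulrDr; lra.
rewrite /w; case: ifPn => iX; first by rewrite mulr1 ltW // iL.
have tl0 := th0 l.
have [yp|ltpy] := leqP y p.
  have -> : y = p by apply/eqP; rewrite eqn_leq yp py.
  by rewrite subrr mulr_ge0 // ler0n.
have y0 : (0 < y)%N by apply: leq_ltn_trans ltpy.
(* By minimality of [y] the arc without its last good is worth less than [theta l], and that good
   adds at most [theta l]. *)
have sm := small l y.-1 lX; rewrite prednK // in sm.
have : V l y.-1 - V l p < theta l.
  rewrite ltNge; apply/negP => tl.
  have : (y <= y.-1)%N.
    apply: ymin; rewrite /Q; apply/andP; split; first by rewrite -ltnS prednK.
    by apply/existsP; exists l; rewrite lA.
  by rewrite -ltnS prednK // ltnn.
lra.
Qed.

(** * Periodic chains of cuts and a common starting point *)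

Lemma chain_locate (m n : nat) (b : nat -> nat) (x : nat) :
  (0 < m)%N -> (0 < n)%N -> (forall k, b (k + n) = b k + m)%N ->
  (b 0 <= x)%N -> exists k, (b k <= x < b k.+1)%N.
Proof.
move=> m0 n0 per b0x.
(* Periodicity makes [b] unbounded, so there is a first index whose cut exceeds [x]; its predecessor
   is the index sought. *)
have big r : (r * m <= b (r * n))%N.
  by elim: r => // r IH; rewrite !mulSn addnC [(n + _)%N]addnC per leq_add2r.
have ex : exists k, (x < b k)%N.
  exists (x.+1 * n)%N; apply: leq_trans (big _).
  by rewrite -{1}(muln1 x.+1) leq_mul.
case: (ex_minnP ex) => [[|k]] xk kmin; first by move: xk; rewrite ltnNge b0x.
exists k; rewrite xk andbT leqNgt; apply/negP => /kmin; by rewrite ltnn.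
Qed.

Lemma homo_succ (b : nat -> nat) :
  (forall k, b k <= b k.+1)%N -> {homo b : x y / (x <= y)%N}.
Proof. by move=> bS; apply: homo_leq => //; apply: leq_trans. Qed.

(* A common starting point a i for two utilities.  The sequence q bounds the
   successive cuts of a moving knife as long as an agent with utility V2 waits;
   for the first cut it is enough that an agent with utility V1 would stop the
   knife.  If neither a i.+1 nor an end of the bundle of b around a i is
   suitable for any i, every cut of a lies in the middle of a bundle of b, with
   value more than (1 - c) * M2 on both sides, and the arcs of a are worth at
   least 2 * (1 - c) * M2 >= c * M2. *)
Lemma common_start (R : realFieldType) (m n : nat) (V1 V2 : nat -> R)
    (M1 M2 c : R) (a b : nat -> nat) :
  (0 < m)%N -> (0 < n)%N ->
  {homo V1 : x y / (x <= y)%N >-> x <= y} ->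
  {homo V2 : x y / (x <= y)%N >-> x <= y} ->
  (forall x y, V2 (x + m)%N - V2 (y + m)%N = V2 x - V2 y) ->
  0 <= M1 -> 0 <= M2 -> 0 <= c -> 3%:R * c <= 2%:R ->
  (forall k, a (k + n) = a k + m)%N -> (forall k, b (k + n) = b k + m)%N ->
  (forall k, a k <= a k.+1)%N -> (forall k, b k <= b k.+1)%N ->
  (forall k, M1 <= V1 (a k.+1) - V1 (a k)) ->
  (forall k, M2 <= V2 (b k.+1) - V2 (b k)) ->
  (b 0 <= m)%N ->
  exists i q,
  [/\ q 0 = a i, (q n <= a i + m)%N, forall k, (k < n)%N -> (q k <= q k.+1)%N,
      c * M1 <= V1 (q 1) - V1 (q 0) \/ c * M2 <= V2 (q 1) - V2 (q 0)
    & forall k, (0 < k < n)%N -> c * M2 <= V2 (q k.+1) - V2 (q k)].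
Proof.
move=> m0 n0 V1m V2m V2p M10 M20 c0 c23 aper bper aS bS aM bM b0.
have am := homo_succ aS; have bm := homo_succ bS.
have cM1 : c * M1 <= M1 by nra.
have cM2 : c * M2 <= M2 by nra.
(* From index [n] on, [a i] is at least [m], hence at least [b 0]. *)
have loc i : (n <= i)%N -> exists k, (b k <= a i < b k.+1)%N.
  move=> ni; apply: (chain_locate m0 n0 bper); apply: leq_trans b0 _.
  by rewrite -(subnK ni) aper leq_addl.
have finish i k : (b k <= a i < b k.+1)%N ->
    [\/ (a i.+1 <= b k.+1)%N, c * M2 <= V2 (b k.+1) - V2 (a i)
      | c * M2 <= V2 (a i) - V2 (b k)] ->
  exists q,
  [/\ q 0 = a i, (q n <= a i + m)%N, forall k, (k < n)%N -> (q k <= q k.+1)%N,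
      c * M1 <= V1 (q 1) - V1 (q 0) \/ c * M2 <= V2 (q 1) - V2 (q 0)
    & forall k, (0 < k < n)%N -> c * M2 <= V2 (q k.+1) - V2 (q k)].
  move=> /andP[bka akb] alt.
  have [left|nleft] := boolP (c * M2 <= V2 (a i) - V2 (b k)).
    (* The first arc contains the full bundle from [b k.+1] to [b k.+2]; the last one is the piece
       from [b k] to [a i], one turn later. For [n = 1] the only arc is the whole turn, an arc of
       [a]. *)
    exists (fun r => if r == 0 then a i else if (r < n)%N then b (k.+1 + r)%N else (a i + m)%N).
    split=> //=.
    + by rewrite ltnn gtn_eqF.
    + case=> [|r] rn /=.
        case: ifP => _; last exact: leq_addr.
        by rewrite (leq_trans (ltnW akb)) // bm //; lia.
      rewrite rn; case: ifP => _; first by apply: bm; lia.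
      have : (b (k.+1 + r.+1) <= b (k + n))%N by apply: bm; lia.
      by rewrite bper => h; apply: leq_trans h _; rewrite leq_add2r.
    + case: ifPn => [n1|n1]; [right|left].
        have := bM k.+1; rewrite addn1.
         have := V2m _ _ (ltnW akb); lra.
      have e : n = 1%N by lia.
      by have := aM i; move: (aper i); rewrite e addn1 => ->; lra.
    + case=> // r /andP[_ rn] /=; rewrite rn; case: ifPn => rn'.
        by have := bM (k.+1 + r.+1)%N; rewrite (addnS k.+1 r.+1); lra.
      have -> : (k.+1 + r.+1 = k + n)%N by lia.
      by rewrite bper V2p.
  (* Only the first arc is not a full bundle of [b]; the remaining alternatives for [alt] say that
     it suffices for [V1] or for [V2]. *)
  exists (fun r => if r == 0 then a i else b (k + r)%N); split=> //=.
  - by rewrite gtn_eqF // bper leq_add2r.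
  - case=> [|r] rn /=; first by rewrite addn1 ltnW.
    by rewrite bm //; lia.
  - rewrite addn1; case: alt => [alt|alt|alt]; [left|by right|by rewrite alt in nleft].
    by have := V1m _ _ alt; have := aM i; lra.
  - by case=> // r _ /=; have := bM (k + r.+1)%N; rewrite (addnS k r.+1); lra.
have key i : (n <= i)%N -> c * M2 <= V2 (a i.+1) - V2 (a i) \/
  exists i k, (b k <= a i < b k.+1)%N /\
    [\/ (a i.+1 <= b k.+1)%N, c * M2 <= V2 (b k.+1) - V2 (a i)
      | c * M2 <= V2 (a i) - V2 (b k)].
  move=> ni; have [k kP] := loc i ni.
  have [k' kP'] := loc i.+1 (leqW ni).
  have [h|h1] := boolP (a i.+1 <= b k.+1)%N; first by right; exists i, k; split=> //; constructor 1.
  have [h|h2] := boolP (c * M2 <= V2 (a i) - V2 (b k)); first by right; exists i, k; split=> //; constructor 3.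
  have [h|h3] := boolP (c * M2 <= V2 (b k'.+1) - V2 (a i.+1)); first by right; exists i.+1, k'; split=> //; constructor 2.
  left; move: h1 h2 h3; rewrite -ltnNge -!ltNge => h1 h2 h3.
  (* The two cuts lie in different bundles of [b], so the end pieces of the arc from [a i] to
     [a i.+1] are disjoint and their values add up. *)
  have kk : (k < k')%N.
    rewrite ltnNge; apply/negP => k'k; have := bm k'.+1 k.+1 k'k; move: kP kP'; lia.
  have := V2m _ _ (bm _ _ kk); have := bM k; have := bM k'.
  nra.
(* The [n] arcs of [a] from index [n] on make one turn. If all are worth [c * M2], then [a] itself
   serves as [q]; otherwise [key] yields a start. *)
have [/existsP[r]|/existsPn good_cuts] :=
  boolP [exists r : 'I_n, ~~ (c * M2 <= V2 (a (n + r).+1) - V2 (a (n + r)%N))].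
  case: (key (n + r)%N (leq_addr _ _)) => [-> //|[i [k [ik alt]]] _].
  by exists i; apply: finish alt.
have A r : (r < n)%N -> c * M2 <= V2 (a (n + r).+1) - V2 (a (n + r)%N).
  by move=> rn; have := good_cuts (Ordinal rn); rewrite negbK.
exists n, (fun r => a (n + r)%N); split=> //=.
- by rewrite addn0.
- by rewrite aper.
- by move=> r _; rewrite addnS.
- by right; have := A 0 n0; rewrite addn0 addn1.
- by move=> r /andP[_ rn]; rewrite addnS A.
Qed.

(** * The unrolled cycle, its segments and splits *)

(* The cycle is unrolled: x : nat stands for the edge just before the good x %% m. *)
Definition good (m : nat) (m0 : (0 < m)%N) (x : nat) : 'I_m :=
  Ordinal (ltn_pmod x m0).

Definition cumul (R : realFieldType) (m : nat) (m0 : (0 < m)%N)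
    (u : {ffun 'I_m -> R}) (x : nat) : R :=
  \sum_(0 <= k < x) u (good m0 k).

Lemma good_addm (m : nat) (m0 : (0 < m)%N) (x : nat) :
  good m0 (x + m) = good m0 x.
Proof. by apply: val_inj; rewrite /= modnDr. Qed.

Lemma good_ord (m : nat) (m0 : (0 < m)%N) (g : 'I_m) : good m0 g = g.
Proof. by apply: val_inj; rewrite /= modn_small. Qed.

Lemma good_inj (m : nat) (m0 : (0 < m)%N) (x y z : nat) :
  (z <= x < z + m)%N -> (z <= y < z + m)%N -> good m0 x = good m0 y -> x = y.
Proof.
wlog xy : x y / (x <= y)%N => [H|] hx hy e.
  by case/orP: (leq_total x y) => ?; [|symmetry]; apply: H.
have /eqP := congr1 val e; rewrite /= eq_sym eqn_mod_dvd // => /dvdnP[k].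
case: k => [|k]; nia.
Qed.

Lemma good_onto (m : nat) (m0 : (0 < m)%N) (z : nat) (g : 'I_m) :
  exists2 x, (z <= x < z + m)%N & good m0 x = g.
Proof.
(* The offset is the residue of [g - z] modulo [m], written so that no subtraction truncates. *)
exists (z + (g + (m - z %% m)) %% m)%N.
  by rewrite leq_addr ltn_add2l ltn_pmod.
apply: val_inj; rewrite /= modnDmr.
have zm := ltn_pmod z m0; have := divn_eq z m; move: zm.
set r := (z %% m)%N; set d := (z %/ m)%N => zm zE.
have -> : (z + (g + (m - r)) = d.+1 * m + g)%N by rewrite mulSn; lia.
by rewrite modnMDl modn_small.
Qed.

Lemma cumul_cat (R : realFieldType) (m : nat) (m0 : (0 < m)%N)
    (u : {ffun 'I_m -> R}) (x y : nat) : (x <= y)%N ->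
  cumul m0 u y - cumul m0 u x = \sum_(x <= k < y) u (good m0 k).
Proof. by move=> xy; rewrite /cumul (@big_cat_nat _ _ _ x 0 y) //=; lra. Qed.

Lemma cumulS (R : realFieldType) (m : nat) (m0 : (0 < m)%N)
    (u : {ffun 'I_m -> R}) (x : nat) :
  cumul m0 u x.+1 - cumul m0 u x = u (good m0 x).
Proof. by rewrite cumul_cat // big_nat1. Qed.

Lemma cumul_homo (R : realFieldType) (m : nat) (m0 : (0 < m)%N)
    (u : {ffun 'I_m -> R}) : (forall g, 0 <= u g) ->
  {homo cumul m0 u : x y / (x <= y)%N >-> x <= y}.
Proof. by move=> u0 x y xy; rewrite -subr_ge0 cumul_cat // sumr_ge0. Qed.

Lemma cumul_period (R : realFieldType) (m : nat) (m0 : (0 < m)%N)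
    (u : {ffun 'I_m -> R}) (x : nat) :
  cumul m0 u (x + m) = cumul m0 u x + cumul m0 u m.
Proof.
elim: x => [|x IH]; first by rewrite add0n {2}/cumul big_nil add0r.
have := cumulS m0 u (x + m); have := cumulS m0 u x.
by rewrite good_addm IH addSn; lra.
Qed.

Definition segment (m : nat) (m0 : (0 < m)%N) (x y : nat) : {set 'I_m} :=
  [set g in [seq good m0 k | k <- index_iota x y]].

Lemma segmentP (m : nat) (m0 : (0 < m)%N) (x y : nat) (g : 'I_m) :
  reflect (exists2 k, (x <= k < y)%N & g = good m0 k) (g \in segment m0 x y).
Proof.
rewrite inE; apply: (iffP mapP) => -[k kP ->]; exists k => //;
by move: kP; rewrite mem_index_iota.
Qed.

(** Within one turn no good repeats, so the sum over positions is a sum over goods. *)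
Lemma uval_segment (R : realFieldType) (m : nat) (m0 : (0 < m)%N)
    (u : {ffun 'I_m -> R}) (x y : nat) : (x <= y <= x + m)%N ->
  uval u (segment m0 x y) = cumul m0 u y - cumul m0 u x.
Proof.
move=> /andP[xy yx]; rewrite cumul_cat // -(big_map (good m0) xpredT u).
rewrite big_uniq /=; first by apply: eq_bigl => g; rewrite inE.
rewrite map_inj_in_uniq ?iota_uniq // => k l; rewrite !mem_index_iota => kP lP.
apply: (@good_inj _ _ _ _ x); lia.
Qed.

Lemma uval_le (R : realFieldType) (m : nat) (u : {ffun 'I_m -> R})
    (S T : {set 'I_m}) :
  (forall g, 0 <= u g) -> S \subset T -> uval u S <= uval u T.
Proof.
move=> u0 ST; rewrite /uval [X in _ <= X](big_setID S) /= (setIidPr ST).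
by rewrite lerDl sumr_ge0.
Qed.

Lemma cyc_adj_sym (m : nat) : symmetric (@cyc_adj m).
Proof. by move=> x y; rewrite /cyc_adj orbC. Qed.

Lemma cyc_adjS (m : nat) (m0 : (0 < m)%N) (x : nat) :
  cyc_adj (good m0 x) (good m0 x.+1).
Proof. by rewrite /cyc_adj /= -[in X in _ == X]addn1 modnDml addn1 eqxx. Qed.

Lemma bundle_segment (m : nat) (m0 : (0 < m)%N) (x y : nat) : bundle (segment m0 x y).
Proof.
have conn k l : (x <= k <= l)%N -> (l < y)%N ->
    connect (induced_adj (segment m0 x y)) (good m0 k) (good m0 l).
  move=> /andP[xk kl] ly; move: kl ly.
  elim: l => [|l IH]; first by rewrite leqn0 => /eqP->.
  rewrite leq_eqVlt => /orP[/eqP-> //|kl] ly.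
  apply: connect_trans (IH kl (ltnW ly)) (connect1 _).
  rewrite /induced_adj cyc_adjS andbT; apply/andP; split; apply/segmentP.
    by exists l => //; rewrite (leq_trans xk kl) ltnW.
  by exists l.+1 => //; rewrite (leq_trans xk (ltnW kl)).
have csym : connect_sym (induced_adj (segment m0 x y)).
  apply: sym_connect_sym => g h; rewrite /induced_adj cyc_adj_sym.
  by case: (g \in _); case: (h \in _).
apply/forall_inP => g /segmentP[k /andP[xk ky] ->].
apply/forall_inP => h /segmentP[l /andP[xl ly] ->].
have [kl|/ltnW lk] := leqP k l; first by apply: conn; rewrite ?xk.
by rewrite csym conn ?xl.
Qed.

Lemma split_of_tiling : forall (m n : nat) (m0 : (0 < m)%N) (p : nat)
    (lo hi : 'I_n -> nat),
  (forall i, (p <= lo i <= hi i)%N /\ (hi i <= p + m)%N) ->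
  (forall x, (p <= x < p + m)%N -> exists i, (lo i <= x < hi i)%N) ->
  (forall i j, i != j -> (hi i <= lo j)%N || (hi j <= lo i)%N) ->
  is_split [ffun i => segment m0 (lo i) (hi i)].
Proof.
move=> m n m0 p lo hi lohi cov dis; apply/and3P; split.
- by apply/forallP => i; rewrite ffunE bundle_segment.
- apply/forallP => i; apply/forallP => j; apply/implyP => ij.
  rewrite !ffunE; apply/pred0P => g /=; apply/negP => /andP[].
  move=> /segmentP[k kP ->] /segmentP[l lP e].
  have := lohi i; have := lohi j; have := dis i j ij => h1 [h2 h3] [h4 h5].
  have : k = l by apply: (@good_inj _ m0 _ _ p) e; lia.
  lia.
apply/eqP/setP => g; rewrite inE; apply/bigcupP.
have [x xP <-] := good_onto m0 p g; have [i ix] := cov x xP.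
by exists i => //; rewrite ffunE; apply/segmentP; exists x.
Qed.

(** * Maximin splits as periodic chains of cuts *)

Lemma mms_attained (R : realFieldType) (m n : nat) (u : {ffun 'I_m -> R}) :
  (forall g, 0 <= u g) ->
  0 <= mms n u /\ (mms n u = 0 \/
    exists P : {ffun 'I_n -> {set 'I_m}},
      is_split P /\ forall i, mms n u <= uval u (P i)).
Proof.
move=> u0; rewrite /mms.
(* The maximum of two values is one of them, so a witness survives; [x = 0] covers the neutral
   element. *)
apply: (@big_ind R (fun x => 0 <= x /\ (x = 0 \/
   exists P : {ffun 'I_n -> {set 'I_m}},
     is_split P /\ forall i, x <= uval u (P i)))).
- by split; [|left].
- by move=> x y; rewrite maxEle; case: ifP.
move=> P splitP; split.
  elim/big_ind: _ => [|x y x0 y0|i _]; first by apply: sumr_ge0.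
    by rewrite le_min x0.
  by apply: sumr_ge0.
right; exists P; split=> // i.
by rewrite (bigD1 i) //= ge_min lexx.
Qed.

(** One turn of cuts is repeated with shift [m]. [Q] abstracts the relation between neighbouring
    cuts; the equation for [a n] joins consecutive turns. *)
Lemma periodic_chain (m n : nat) (a : nat -> nat) (Q : nat -> nat -> Prop) :
  (0 < n)%N -> a n = (a 0 + m)%N ->
  (forall x y r, Q x y -> Q (x + r * m)%N (y + r * m)%N) ->
  (forall k, (k < n)%N -> Q (a k) (a k.+1)) ->
  exists b, [/\ b 0 = a 0, forall k, b (k + n) = (b k + m)%N
             & forall k, Q (b k) (b k.+1)].
Proof.
move=> n0 an Qm Qa; exists (fun k => a (k %% n) + (k %/ n) * m)%N; split.
- by rewrite mod0n div0n addn0.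
- by move=> k; rewrite modnDr divnDr // divnn n0 addn1 mulSn [(m + _)%N]addnC addnA.
move=> k; have kn := ltn_pmod k n0.
have -> : (a (k.+1 %% n) + k.+1 %/ n * m = a (k %% n).+1 + k %/ n * m)%N.
  have kE : (k.+1 = k %/ n * n + (k %% n).+1)%N by rewrite addnS -divn_eq.
  rewrite {1 2}kE modnMDl divnMDl //.
  move: kn; rewrite leq_eqVlt => /orP[/eqP->|lt].
    by rewrite modnn divnn n0 an mulnDl mul1n; lia.
  by rewrite (modn_small lt) (divn_small lt) addn0.
exact/Qm/Qa.
Qed.

(** Start the turn between two neighbouring goods with different owners: a bundle with a gap would
    then be disconnected. If no such place exists, one agent owns every good. *)
Lemma split_contiguous (m n : nat) (m0 : (0 < m)%N)
    (P : {ffun 'I_n -> {set 'I_m}}) : is_split P ->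
  exists2 x0, (x0 <= m)%N & forall i x y z,
    (x0 <= x <= y)%N -> (y <= z < x0 + m)%N ->
    good m0 x \in P i -> good m0 z \in P i -> good m0 y \in P i.
Proof.
case/and3P => /forallP bun /forallP dis /eqP cov.
have uniq_owner i j g : g \in P i -> g \in P j -> i = j.
  move=> gi gj; apply/eqP; apply: contraT => ij.
  have := implyP (forallP (dis i) j) ij.
  by move/pred0P/(_ g) => /=; rewrite gi gj.
have owner g : exists i, g \in P i.
  by have : g \in [set: 'I_m] by []; rewrite -cov => /bigcupP[i _ gi]; exists i.
have [/existsP[c /forallP cut]|/existsPn nocut] := boolP [exists c : 'I_m,
    [forall i, ~~ ((good m0 c \in P i) && (good m0 c.+1 \in P i))]]; last first.
  exists 0 => // i x y z /andP[_ xy] _ xi _; move: xy.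
  have up k : good m0 k \in P i -> good m0 k.+1 \in P i.
    move=> ki; have := nocut (good m0 k).
    rewrite negb_forall => /existsP[j]; rewrite negbK good_ord => /andP[kj].
    have -> : good m0 (val (good m0 k)).+1 = good m0 k.+1.
      by apply: val_inj; rewrite /= -addn1 modnDml addn1.
    by rewrite (uniq_owner _ _ _ ki kj).
  elim: y => [|y IH]; first by rewrite leqn0 => /eqP<-.
  by rewrite leq_eqVlt => /orP[/eqP<-|/IH /up].
exists c.+1 => // i x y z /andP[cx xy] /andP[yz zc] xi zi.
apply: contraT => yi.
have csym : connect_sym (induced_adj (P i)).
  apply: sym_connect_sym => g h; rewrite /induced_adj cyc_adj_sym.
  by case: (g \in _); case: (h \in _).
(* Leaving the part before [y] inside [P i] would require either the missing good at [y] or crossing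
   the cut after [c]. *)
have closedA : closed (induced_adj (P i)) (segment m0 c.+1 y).
  apply: (intro_closed csym) => g h /and3P[gi hi adj] /segmentP[k kP gk].
  have [l lP lh] := good_onto m0 c.+1 h.
  apply/segmentP; exists l => //.
  have [e|e] : good m0 l = good m0 k.+1 \/ good m0 k = good m0 l.+1.
    case/orP: adj => /eqP e; [left|right]; apply: val_inj.
      by rewrite lh /= e gk /= -addn1 modnDml addn1.
    by rewrite -gk e -lh /= -addn1 modnDml addn1.
  - have lk : l = k.+1 by apply: (@good_inj _ m0 _ _ c.+1) e; lia.
    have : l != y by apply: contraNneq yi => <-; rewrite lh.
    lia.
  have [lc|lc] := ltnP l.+1 (c.+1 + m).
    have : k = l.+1 by apply: (@good_inj _ m0 _ _ c.+1) e; lia.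
    lia.
  have lE : l = (c + m)%N by lia.
  case/negP: (cut i); rewrite -[good m0 c](good_addm m0 c) -lE lh hi.
  by rewrite -[good m0 c.+1](good_addm m0 c.+1) addSn -lE -e -gk.
have := closed_connect closedA (implyP (forallP (implyP (forallP (bun i) _) xi) _) zi).
have -> : good m0 x \in segment m0 c.+1 y.
  apply/segmentP; exists x => //; rewrite cx /= ltn_neqAle xy andbT.
  by apply: contraNneq yi => <-.
move/esym/segmentP => [k kP zk].
have : z = k by apply: (@good_inj _ m0 _ _ c.+1) zk; lia.
lia.
Qed.

(** As [M] is positive, no bundle is empty. The last positions of the bundles in one turn are
    distinct, and sorting them gives the cuts. *)
Lemma chain_of_split (R : realFieldType) (m n : nat) (m0 : (0 < m)%N)
    (u : {ffun 'I_m -> R}) (P : {ffun 'I_n -> {set 'I_m}}) (M : R) :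
  (0 < n)%N -> (forall g, 0 <= u g) -> 0 < M -> is_split P ->
  (forall i, M <= uval u (P i)) ->
  exists b, [/\ (b 0 <= m)%N, forall k, b (k + n) = (b k + m)%N,
    forall k, (b k <= b k.+1)%N
    & forall k, M <= cumul m0 u (b k.+1) - cumul m0 u (b k)].
Proof.
move=> n0 u0 M0 splitP MP; have [x0 x0m contig] := split_contiguous m0 splitP.
have uniq_owner i j g : g \in P i -> g \in P j -> i = j.
  case/and3P: splitP => _ /forallP dis _ gi gj; apply/eqP; apply: contraT => ij.
  have := implyP (forallP (dis i) j) ij.
  by move/pred0P/(_ g) => /=; rewrite gi gj.
have nonempty i : exists g, g \in P i.
  apply/set0Pn; apply: contraTneq (MP i) => ->.
  by rewrite /uval big_set0 -ltNge.
have /fin_all_exists[last lastP] : forall i, exists l,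
    [/\ (x0 <= l < x0 + m)%N, good m0 l \in P i
      & forall k, (x0 <= k < x0 + m)%N -> good m0 k \in P i -> (k <= l)%N].
  move=> i; have [g gi] := nonempty i; have [x xP xg] := good_onto m0 x0 g.
  pose p k := (x0 <= k < x0 + m)%N && (good m0 k \in P i).
  have exp : exists k, p k by exists x; rewrite /p xP xg.
  have ubp k : p k -> (k <= x0 + m)%N by case/andP => /andP[_ /ltnW].
  case: (ex_maxnP exp ubp) => l /andP[lP li] lmax; exists l; split=> // k kP ki.
  by apply: lmax; rewrite /p kP.
have last_inj : injective last.
  move=> i j e; have [_ li _] := lastP i; have [_ lj _] := lastP j.
  by apply: uniq_owner li _; rewrite e.
pose s := sort leq [seq last i | i <- enum 'I_n].
have ssize : size s = n by rewrite size_sort size_map size_enum_ord.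
have ssorted : sorted ltn s.
  rewrite ltn_sorted_uniq_leq sort_uniq (map_inj_uniq last_inj) enum_uniq.
  exact/sort_sorted/leq_total.
(* A cut follows each last position; the final one is put at [x0 + m] to close the turn. *)
pose a k := if k is k'.+1 then if k == n then (x0 + m)%N else (nth 0%N s k').+1
            else x0.
pose Q x y := (x <= y)%N /\ M <= cumul m0 u y - cumul m0 u x.
have [|x y r [xy Mxy]|k kn|b [b0 bper bQ]] := @periodic_chain m n a Q n0.
- by rewrite /a; case: (n) n0 => // n' _; rewrite eqxx.
- split; first by rewrite leq_add2r.
  apply: le_trans Mxy _; elim: r => [|r IH]; first by rewrite !addn0.
  apply: le_trans IH _; rewrite mulSn [(m + _)%N]addnC !addnA.
  rewrite !(cumul_period m0 u (_ + _)); lra.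
- have /mapP[i _ sk] : nth 0%N s k \in [seq last i | i <- enum 'I_n].
    by rewrite -(mem_sort leq) mem_nth // ssize.
  have [lP li lmax] := lastP i.
  (* A good of agent [i] before [a k] would, by contiguity, give [i] the last good of another
     agent. *)
  have inside z : (x0 <= z < x0 + m)%N -> good m0 z \in P i ->
      (a k <= z < a k.+1)%N.
    move=> zP zi; have zl := lmax z zP zi; apply/andP; split; last first.
      by rewrite /a; case: eqP => _; [case/andP: zP|rewrite sk].
    rewrite /a; case: k kn sk => [|k] kn sk; first by case/andP: zP.
    rewrite ltn_eqF // ltnNge; apply/negP => zk.
    have kk : (nth 0%N s k < nth 0%N s k.+1)%N.
      by apply: (sorted_ltn_nth ltn_trans) => //; rewrite inE ssize // ltnW.
    have /mapP[j _ skj] : nth 0%N s k \in [seq last i | i <- enum 'I_n].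
      by rewrite -(mem_sort leq) mem_nth // ssize ltnW.
    have [_ lj _] := lastP j; rewrite -skj in lj.
    have ki : good m0 (nth 0%N s k) \in P i.
      by apply: (contig i z _ (last i)) => //; lia.
    by move: kk; rewrite sk skj (uniq_owner _ _ _ ki lj) ltnn.
  have sub : P i \subset segment m0 (a k) (a k.+1).
    apply/subsetP => g gi; have [z zP zg] := good_onto m0 x0 g.
    by apply/segmentP; exists z => //; apply: inside; rewrite ?zg.
  have /andP[al la] := inside _ lP li.
  split; first exact: leq_trans al (ltnW la).
  apply: le_trans (MP i) _; rewrite -uval_segment; first exact: uval_le.
  rewrite (leq_trans al (ltnW la)) /=.
  have x0a : (x0 <= a k)%N.
    rewrite /a; case: k kn {sk inside al la sub} => // k kn.
    rewrite ltn_eqF //; have /mapP[j _ skj] : nth 0%N s k \in [seq last i | i <- enum 'I_n].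
      by rewrite -(mem_sort leq) mem_nth // ssize ltnW.
    by have [/andP[lj _] _ _] := lastP j; rewrite skj leqW.
  have : (a k.+1 <= x0 + m)%N.
    by rewrite /a; case: eqP => // _; rewrite sk; case/andP: lP.
  by move=> /leq_trans; apply; rewrite leq_add2r.
by exists b; split=> // [|k|k]; [rewrite b0 | have [] := bQ k | have [] := bQ k].
Qed.

Lemma mms_chain (R : realFieldType) (m n : nat) (m0 : (0 < m)%N)
    (u : {ffun 'I_m -> R}) :
  (0 < n)%N -> (forall g, 0 <= u g) ->
  exists b, [/\ (b 0 <= m)%N, forall k, b (k + n) = (b k + m)%N,
    forall k, (b k <= b k.+1)%N
    & forall k, mms n u <= cumul m0 u (b k.+1) - cumul m0 u (b k)].
Proof.
move=> n0 u0; have [M0 attained] := mms_attained n u0.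
have [M0E|Mn0] := eqVneq (mms n u) 0; last first.
  case: attained => [M0E|[P [splitP MP]]]; first by rewrite M0E eqxx in Mn0.
  by apply: chain_of_split splitP MP => //; rewrite lt_neqAle eq_sym Mn0.
have bS k : (k %/ n * m <= k.+1 %/ n * m)%N by rewrite leq_mul2r leq_div2r ?orbT.
(* A share of 0 allows empty arcs: of every [n] arcs, one is a full turn and the rest are empty. *)
exists (fun k => k %/ n * m)%N; split=> //.
- by rewrite div0n.
- by move=> k; rewrite divnDr // divnn n0 mulnDl mul1n.
- by move=> k; rewrite M0E subr_ge0 cumul_homo.
Qed.

(** * Counting the agents of the two largest types *)

Lemma two_largest_classes (T : eqType) (n t : nat) (f : 'I_n -> T) :
  (0 < n)%N -> (2 <= t)%N -> (size (undup [seq f i | i <- enum 'I_n]) <= t)%N ->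
  exists i j, (2 * n <= t * #|[set k | (f k == f i) || (f k == f j)]|)%N.
Proof.
move=> n0 t2 st; pose c i := #|[set k | f k == f i]|.
pose i0 : 'I_n := Ordinal n0.
have [i _ ci] := @arg_maxnP _ i0 xpredT c isT.
have [/existsP[j0 j0i]|/existsPn one] := boolP [exists j, f j != f i]; last first.
  exists i, i; have -> : [set k | (f k == f i) || (f k == f i)] = setT.
    by apply/setP => k; rewrite !inE; have := one k; rewrite negbK => ->.
  by rewrite cardsT card_ord leq_mul2r t2 orbT.
have [j ji cj] := @arg_maxnP _ j0 (fun k => f k != f i) c j0i.
exists i, j.
have -> : #|[set k | (f k == f i) || (f k == f j)]| = (c i + c j)%N.
  rewrite -(cardsID [set k | f k == f i]); congr addn; apply: eq_card => k.
    by rewrite !inE; case: (f k == f i); rewrite ?andbF ?andbT.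
  rewrite !inE; case: eqVneq => [->|] //=.
  by rewrite eq_sym (negbTE ji).
set s := undup _ in st.
have us : uniq s by apply: undup_uniq.
have mems k : f k \in s by rewrite mem_undup map_f // mem_enum.
have nE : (n = \sum_(x <- s) #|[set k | f k == x]|)%N.
  transitivity (\sum_(k < n) \sum_(x <- s) if f k == x then 1 else 0)%N.
    rewrite -[LHS]card_ord -sum1_card; apply: eq_bigr => k _.
    rewrite -big_mkcond sum1_count -(_ : count_mem (f k) s = 1%N).
      by apply: eq_count => x; rewrite /= eq_sym.
    by rewrite count_uniq_mem // mems.
  rewrite exchange_big; apply: eq_bigr => x _.
  by rewrite -big_mkcond -sum1_card; apply: eq_bigl => k; rewrite inE.
have si := mems i.
have sz : (size s = (size (rem (f i) s)).+1)%N.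
  by rewrite size_rem // prednK //; case: (s) si.
have ci' : (c j <= c i)%N by apply: ci.
(* Every class but the largest has at most [c j] members. With [c j <= c i] and [2 <= t] this gives
   [2 * n <= t * (c i + c j)]. *)
have : (n <= c i + (t - 1) * c j)%N.
  rewrite {1}nE (big_rem (f i)) //= leq_add2l.
  apply: leq_trans (_ : \sum_(x <- rem (f i) s) c j <= _)%N.
    rewrite !big_seq; apply: leq_sum => x.
    rewrite mem_rem_uniq // !inE mem_undup => /andP[xi /mapP[k _ xk]].
    by rewrite xk in xi *; apply: cj.
  rewrite big_const_seq count_predT iter_addn addn0 mulnC leq_mul2r; apply/orP; right; lia.
nia.
Qed.

(** * Choice of the starting edge and the allocation *)

Unset Implicit Arguments.
Set Strict Implicit.

Theorem theorem4p7 (R : realFieldType) (m n t : nat)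
  (U : 'I_n -> {ffun 'I_m -> R})
  (hm : (2 < m)%N) (hn : (0 < n)%N) (ht : (4 <= t)%N)
  (hnonneg : forall (i : 'I_n) (g : 'I_m), 0 <= U i g)
  (htypes : (size (undup [seq U i | i <- enum 'I_n]) <= t)%N) :
  exists P : {ffun 'I_n -> {set 'I_m}},
    c_sufficient (t%:R / (2 * t - 2)%:R) U P.
Proof.
have m0 : (0 < m)%N by apply: leq_trans hm.
set c : R := _ / _.
have cdef : c * (2 * t%:R - 2%:R) = t%:R.
  by rewrite /c natrB ?natrM ?mulfVK //; [rewrite -natrM -natrB ?pnatr_eq0 |]; lia.
have t4 : 4%:R <= t%:R :> R by rewrite ler_nat.
have c0 : 0 <= c by rewrite divr_ge0 ?ler0n.
(* Equivalent to [3 * t <= 2 * (2 * t - 2)], that is, to [4 <= t]. *)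
have c23 : 3%:R * c <= 2%:R by nra.
have Mge0 i : 0 <= mms n (U i) by have [] := mms_attained n (hnonneg i).
pose V i := cumul m0 (U i).
have Vmono i : {homo V i : x y / (x <= y)%N >-> x <= y}.
  exact/cumul_homo/hnonneg.
have Vper i x : V i (x + m)%N = V i x + V i m by apply: cumul_period.
pose theta i := c * mms n (U i).
have theta0 i : 0 <= theta i by apply: mulr_ge0.
have thetaM i : theta i <= mms n (U i) by have := Mge0 i; rewrite /theta; nra.
have chain i := mms_chain m0 hn (hnonneg i).
suff [p0 [lo [hi [lohi cov dis]]]] : exists p0, tiling V theta setT p0 (p0 + m).
  exists [ffun i => segment m0 (lo i) (hi i)]; split.
    apply: (@split_of_tiling _ _ _ p0) => [i|x /cov[i _ ix]|i j ij].
    + by have [-> ->] := lohi i (in_setT i).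
    + by exists i.
    + by apply: dis; rewrite ?inE.
  move=> i; have [h1 h2 h3 h4] := lohi i (in_setT i).
  rewrite ffunE uval_segment // h2 (leq_trans h3) // leq_add2r //.
have [/existsP[i0 /existsP[g gi0]]|/existsPn small] :=
    boolP [exists i, exists g, theta i <= U i g].
  (* The position of [g] one turn later, so that every chain begins at or before it. *)
  exists (g + m)%N.
  have /fin_all_exists[q qP] : forall j, exists q : nat -> nat,
    [/\ q 0 = (g + m)%N, theta i0 <= V i0 (q 1) - V i0 (q 0),
      forall k, (k < n)%N -> (q k <= q k.+1)%N,
      forall k, (0 < k < n)%N -> theta j <= V j (q k.+1) - V j (q k)
      & (q n <= g + m + m)%N].
    move=> j; have [b [b0 bper bS bM]] := chain j.
    have [k /andP[kg gk]] := @chain_locate m n b (g + m) m0 hn bper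
      (leq_trans b0 (leq_addl _ _)).
    (* The first arc contains [g], which is enough for [i0]; all later arcs are full bundles of
       [j]. *)
    exists (fun r => if r == 0 then g + m else b (k + r))%N; split=> //=.
    - rewrite addn1; apply: le_trans gi0 _.
      have := cumulS m0 (U i0) (g + m); rewrite good_addm good_ord => <-.
      by rewrite lerB // Vmono.
    - case=> [|r] rn /=; first by rewrite addn1 ltnW.
      by rewrite (addnS k r.+1).
    - case=> // r _ /=; have := bM (k + r.+1)%N; rewrite (addnS k r.+1).
      exact: le_trans.
    - by rewrite gtn_eqF // bper leq_add2r.
  apply: (@moving_knife _ _ _ _ setT q) => //.
  + by move=> j _; have [-> _ _ _ ->] := qP j.
  + by move=> j k _; have [_ _ h _ _] := qP j; apply: h.
  + by move=> j _; exists i0; have [_ h _ _ _] := qP j.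
  + by move=> j k _; have [_ _ _ h _] := qP j; apply: h.
  + by move=> l x; rewrite inE.
  + by move=> l; rewrite inE.
  + exact: leq_addr.
have [i1 [i2 big]] := two_largest_classes hn (leq_trans (isT : 2 <= 4)%N ht) htypes.
set X := [set _ | _] in big.
have [a [_ aper aS aM]] := chain i1.
have [b [b0 bper bS bM]] := chain i2.
have [|i [q2 [q20 q2n q2S q21 q2k]]] := @common_start R m n (V i1) (V i2) _ _ c a b
  m0 hn (Vmono i1) (Vmono i2) _ (Mge0 i1) (Mge0 i2) c0 c23 aper bper aS bS aM bM b0.
  by move=> x y; rewrite (Vper _ x) (Vper _ y); lra.
exists (a i).
(* Agents of the type of [i1] follow their own chain [a] from its cut [a i]; the other agents of [X]
   follow [q2]. *)
pose q j k := if U j == U i1 then a (i + k)%N else q2 k.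
have VE j j' : U j = U j' -> V j = V j' by rewrite /V => ->.
have thE j j' : U j = U j' -> theta j = theta j' by rewrite /theta => ->.
apply: (@moving_knife _ _ _ _ X q) => //.
+ move=> j _; rewrite /q; case: ifP => _; first by rewrite addn0 aper.
  by rewrite q20.
+ by move=> j k _ kn; rewrite /q; case: ifP => _; [rewrite addnS | apply: q2S].
+ move=> j; rewrite inE /q; case: eqP => [e _|_ /= /eqP e].
    by exists i1; rewrite addn0 addn1; apply: le_trans (aM i).
  by case: q21 => h; [exists i1 | exists i2].
+ move=> j k; rewrite inE /q; case: eqP => [e _ _|_ /= /eqP e kn].
    by rewrite (VE _ _ e) (thE _ _ e) addnS; apply: le_trans (aM _).
  by rewrite (VE _ _ e) (thE _ _ e) q2k.
+ move=> l x _; rewrite /V cumulS; have /existsPn/(_ (good m0 x)) := small l.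
  by rewrite -ltNge => /ltW.
+ move=> l lX; have [d [_ dper dS dM]] := chain l.
  have tot : n%:R * mms n (U l) <= V l (a i + m)%N - V l (a i).
    have : forall r, r%:R * mms n (U l) <= V l (d r) - V l (d 0%N).
      elim=> [|r IH]; first by rewrite mul0r subrr.
      by have := dM r; rewrite -natr1 mulrDl mul1r -/(V l); lra.
    by move=> /(_ n); rewrite (dper 0%N : d n = _) !Vper; lra.
  have Xn : (#|X| < n)%N.
    rewrite -[X in (_ < X)%N]card_ord -cardsT; apply: proper_card.
    by apply/properP; split; [apply: subsetT | exists l].
  have e : (2 * n - #|X| - 1)%:R = 2%:R * n%:R - #|X|%:R - 1 :> R.
    by rewrite -subnDA natrB ?natrD ?natrM; [lra | lia].
  have big' : 2%:R * n%:R <= t%:R * #|X|%:R :> R by rewrite -!natrM ler_nat.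
  apply: le_trans tot; rewrite e /theta -mulrA [mms _ _ * _]mulrC mulrA.
  apply: ler_wpM2r => //.
  have t0 : 0 < t%:R :> R by lra.
  (* Follows from [2 * n <= t * #|X|]; multiplied by [c], with [cdef], it gives
     [c * (2 * n - #|X| - 1) <= n]. *)
  have tX : t%:R * (2%:R * n%:R - #|X|%:R - 1) <= n%:R * (2%:R * t%:R - 2%:R) :> R.
    by lra.
  rewrite -(ler_pM2l t0) mulrCA; apply: le_trans (ler_wpM2l c0 tX) _.
  by rewrite mulrCA cdef mulrC.
+ exact: leq_addr.
Qed.
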